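(* Let $N>0$ be an integer and let $A$ be a commutative ring having property $(\mathsf{P}_N)$, with $T\subset A^\times$ the corresponding cyclic subgroup of order $N$. Let $u:A\to B$ be a Galois morphism whose group $G$ is a finite abelian group, of rank $d=\mathrm{Card}(G)$ dividing $N$. Put $G'=\mathrm{Hom}(G,T)$ and, for $\theta\in G'$, $$L_\theta=\{b\in B:\ \forall g\in G,\ \theta(g)\,g(b)=b\}.$$ Then the morphism of $A$-algebras $$f:\bigoplus_{\theta\in G'}L_\theta\longrightarrow B,$$ induced by the inclusions $L_\theta\subset B$, is an isomorphism.
   Context: Property $(\mathsf{P}_N)$ of a commutative ring $A$: the multiplicative group $A^\times$ contains a subgroup $T$ which is cyclic of order $N$ and such that for every $t\in T$ with $t\neq 1$, the element $1-t$ is invertible in $A$. Let $G$ be a finite group. A morphism $u:A\to B$ of commutative rings is called Galois with group $G$ if $G$ acts on $B$ by ring automorphisms in such a way that: (1) $B^G=A$; (2) the ring morphism $\rho_{B,G}:B\otimes_A B\to\prod_G B$, $x\otimes y\mapsto (g\mapsto x\,g(y))$, is an isomorphism; (3) $u$ makes $B$ a finitely generated projective $A$-module (necessarily of rank $\mathrm{Card}(G)$). Elements of $A$ act on $B$ through $u$. One has $L_1=A$ and $L_\theta\cdot L_{\theta'}\subset L_{\theta\theta'}$ in $B$, and the direct sum $\bigoplus_{\theta\in G'}L_\theta$ is given the $A$-algebra structure defined by these products. *)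

(* Defs.v *)
From HB Require Import structures.
From mathcomp Require Import all_boot all_fingroup all_algebra all_solvable.
From mathcomp Require Import finmap boolp.

Set Implicit Arguments.
Unset Strict Implicit.
Unset Printing Implicit Defensive.

Import GRing.Theory.
Local Open Scope ring_scope.

(* Commutative rings are allowed to be zero, hence [comPzRingType]; there
   MathComp provides neither [GRing.unit] nor algebra structures. *)

Definition invertible (A : comPzRingType) (x : A) : Prop := exists y, x * y = 1.

Record unitSubgroup (A : comPzRingType) := UnitSubgroup {
  us_carrier :> {fset A};
  us_one : 1 \in us_carrier;
  us_mul : forall x y,
    x \in us_carrier -> y \in us_carrier -> x * y \in us_carrier;
  us_inv : forall x, x \in us_carrier -> exists2 y, y \in us_carrier & x * y = 1
}.

Definition us_elt (A : comPzRingType) (T : unitSubgroup A) : Type :=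
  fset_sub_type (us_carrier T).

Section UnitSubgroupTheory.
Variables (A : comPzRingType) (T : unitSubgroup A).

HB.instance Definition _ := Finite.copy (us_elt T) (fset_sub_type (us_carrier T)).

Definition us_val (t : us_elt T) : A := fsval t.

Definition us_mk (x : A) (Tx : x \in us_carrier T) : us_elt T := FSetSub Tx.

Lemma us_val_in t : us_val t \in us_carrier T. Proof. exact: fsvalP. Qed.

Lemma us_val_inj : injective us_val. Proof. exact: val_inj. Qed.

Definition us_elt_one : us_elt T := us_mk (us_one T).

Definition us_elt_mul (s t : us_elt T) : us_elt T :=
  us_mk (us_mul (us_val_in s) (us_val_in t)).

Lemma us_elt_inv_ex (t : us_elt T) : exists s : us_elt T, us_val t * us_val s == 1.
Proof.
have [y Ty txy] := us_inv (us_val_in t).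
by exists (us_mk Ty); apply/eqP.
Qed.

Definition us_elt_inv (t : us_elt T) : us_elt T := xchoose (us_elt_inv_ex t).

Lemma us_elt_mulA : associative us_elt_mul.
Proof. by move=> x y z; apply: us_val_inj; rewrite /= mulrA. Qed.

Lemma us_elt_mul1 : left_id us_elt_one us_elt_mul.
Proof. by move=> x; apply: us_val_inj; rewrite /= mul1r. Qed.

Lemma us_elt_mulV : left_inverse us_elt_one us_elt_inv us_elt_mul.
Proof.
move=> x; apply: us_val_inj; rewrite /= mulrC.
exact/eqP/(xchooseP (us_elt_inv_ex x)).
Qed.

HB.instance Definition _ :=
  Finite_isGroup.Build (us_elt T) us_elt_mulA us_elt_mul1 us_elt_mulV.

Lemma us_val1 : us_val 1%g = 1. Proof. by []. Qed.

Lemma us_valM (s t : us_elt T) : us_val (s * t)%g = us_val s * us_val t.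
Proof. by []. Qed.

Lemma us_mulC (s t : us_elt T) : (s * t)%g = (t * s)%g.
Proof. by apply: us_val_inj; rewrite !us_valM mulrC. Qed.

End UnitSubgroupTheory.

(* [A] has property (P_N) when such a [T] exists. *)
Definition P_subgroup (N : nat) (A : comPzRingType) (T : unitSubgroup A) : Prop :=
  [/\ cyclic [set: us_elt T],
      #|[set: us_elt T]| = N
    & forall t : us_elt T, t <> 1%g -> invertible (1 - us_val t)].

(* Hom(G, T), a group for the pointwise product. *)
Definition dual (gT : finGroupType) (A : comPzRingType) (T : unitSubgroup A)
  : Type := {theta : {ffun gT -> us_elt T} | morphic [set: gT] theta}.

Section DualTheory.
Variables (gT : finGroupType) (A : comPzRingType) (T : unitSubgroup A).
Local Notation dual := (dual gT T).

HB.instance Definition _ := Finite.on dual.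

Definition dual_fun (theta : dual) : gT -> us_elt T := val theta.

Lemma dual_funM (theta : dual) g h :
  dual_fun theta (g * h)%g = (dual_fun theta g * dual_fun theta h)%g.
Proof. by apply: (morphicP (valP theta)); rewrite inE. Qed.

Lemma dual_ext (s t : dual) : dual_fun s =1 dual_fun t -> s = t.
Proof. by move=> st; apply/val_inj/ffunP. Qed.

Fact dual_one_morphic : morphic [set: gT] [ffun _ => 1%g : us_elt T].
Proof. by apply/morphicP=> g h _ _; rewrite !ffunE mulg1. Qed.

Fact dual_mul_morphic (s t : dual) :
  morphic [set: gT] [ffun g => (dual_fun s g * dual_fun t g)%g].
Proof.
apply/morphicP=> g h _ _; rewrite !ffunE !dual_funM !mulgA; congr (_ * _)%g.
by rewrite -!mulgA (us_mulC (dual_fun s h)).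
Qed.

Fact dual_inv_morphic (s : dual) : morphic [set: gT] [ffun g => (dual_fun s g)^-1%g].
Proof. by apply/morphicP=> g h _ _; rewrite !ffunE dual_funM invMg us_mulC. Qed.

Definition dual_mk (theta : {ffun gT -> us_elt T}) (H : morphic [set: gT] theta) :
  dual := exist (fun f : {ffun gT -> us_elt T} => morphic [set: gT] f) theta H.
Definition dual_one : dual := dual_mk dual_one_morphic.
Definition dual_mul (s t : dual) : dual := dual_mk (dual_mul_morphic s t).
Definition dual_inv (s : dual) : dual := dual_mk (dual_inv_morphic s).

Fact dual_mulA : associative dual_mul.
Proof.
by move=> r s t; apply: dual_ext => g; rewrite /dual_fun /= !ffunE /dual_fun /= !ffunE mulgA.
Qed.
Fact dual_mul1 : left_id dual_one dual_mul.
Proof.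
by move=> s; apply: dual_ext => g;
  rewrite /dual_fun /= !ffunE /dual_fun /= !ffunE mul1g.
Qed.
Fact dual_mulV : left_inverse dual_one dual_inv dual_mul.
Proof.
by move=> s; apply: dual_ext => g;
  rewrite /dual_fun /= !ffunE /dual_fun /= !ffunE mulVg.
Qed.

HB.instance Definition _ := Finite_isGroup.Build dual dual_mulA dual_mul1 dual_mulV.

Lemma dual1E g : dual_fun 1%g g = 1%g. Proof. exact: ffunE. Qed.

Lemma dualME (s t : dual) g : dual_fun (s * t)%g g = (dual_fun s g * dual_fun t g)%g.
Proof. exact: ffunE. Qed.

Lemma dual_mulC (s t : dual) : (s * t)%g = (t * s)%g.
Proof. by apply: dual_ext => g; rewrite !dualME us_mulC. Qed.

End DualTheory.

(* [B] with [A] acting through [u]; the alias carries the module structure. *)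
Definition alg_of (A B : comPzRingType) (u : {rmorphism A -> B}) : Type := B.

Section AlgOf.
Variables (A B : comPzRingType) (u : {rmorphism A -> B}).

HB.instance Definition _ := GRing.ComPzRing.copy (alg_of u) B.

Definition alg_scale (a : A) (b : alg_of u) : alg_of u := u a * b.

Fact alg_scaleA a b v : alg_scale a (alg_scale b v) = alg_scale (a * b) v.
Proof. by rewrite /alg_scale rmorphM mulrA. Qed.
Fact alg_scale1 : left_id 1 alg_scale.
Proof. by move=> v; rewrite /alg_scale rmorph1 mul1r. Qed.
Fact alg_scaleDr : right_distributive alg_scale +%R.
Proof. by move=> a v w; rewrite /alg_scale mulrDr. Qed.
Fact alg_scaleDl v : {morph alg_scale^~ v : a b / a + b}.
Proof. by move=> a b; rewrite /alg_scale rmorphD mulrDl. Qed.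

HB.instance Definition _ := GRing.Zmodule_isLmodule.Build A (alg_of u)
  alg_scaleA alg_scale1 alg_scaleDr alg_scaleDl.

Lemma alg_scaleE a (b : alg_of u) : a *: b = u a * b. Proof. by []. Qed.

End AlgOf.

Definition finitely_generated (A : comPzRingType) (M : lmodType A) : Prop :=
  exists n (e : 'I_n -> M), forall x, exists c : 'I_n -> A,
    x = \sum_(i < n) c i *: e i.

Definition projective (A : comPzRingType) (P : lmodType A) : Prop :=
  forall (M N : lmodType A) (p : {linear M -> N}) (h : {linear P -> N}),
    (forall y, exists x, p x = y) ->
    exists k : {linear P -> M}, forall x, p (k x) = h x.

Section Tensor.
Variables (A B : comPzRingType) (u : {rmorphism A -> B}).
Implicit Types (s t r : seq (B * B)) (p q : B * B).

(* The list [:: (x1, y1); ...; (xn, yn)] stands for the formal sum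
   x1 (x) y1 + ... + xn (x) yn; [tensor_eq] is the additive congruence generated
   by the bilinearity relations.  The relation [tensor_eq0] is needed because
   formal sums only form a monoid; opposites then exist, [- x (x) y] being
   [(- x) (x) y]. *)
Inductive tensor_eq : seq (B * B) -> seq (B * B) -> Prop :=
| tensor_eq_refl s : tensor_eq s s
| tensor_eq_sym s t : tensor_eq s t -> tensor_eq t s
| tensor_eq_trans s t r : tensor_eq s t -> tensor_eq t r -> tensor_eq s r
| tensor_eq_cat s s' t t' :
    tensor_eq s s' -> tensor_eq t t' -> tensor_eq (s ++ t) (s' ++ t')
| tensor_eq_catC s t : tensor_eq (s ++ t) (t ++ s)
| tensor_eq_Dl x x' y : tensor_eq [:: (x + x', y)] [:: (x, y); (x', y)]
| tensor_eq_Dr x y y' : tensor_eq [:: (x, y + y')] [:: (x, y); (x, y')]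
| tensor_eq0 y : tensor_eq [:: (0, y)] [::]
| tensor_eqZ a x y : tensor_eq [:: (u a * x, y)] [:: (x, u a * y)].

Definition tensor_rel s t : bool := `[< tensor_eq s t >].

Fact tensor_rel_refl : reflexive tensor_rel.
Proof. by move=> s; apply/asboolP; exact: tensor_eq_refl. Qed.
Fact tensor_rel_sym : symmetric tensor_rel.
Proof. by move=> s t; apply/asboolP/asboolP; exact: tensor_eq_sym. Qed.
Fact tensor_rel_trans : transitive tensor_rel.
Proof.
move=> t s r /asboolP st /asboolP tr; apply/asboolP; exact: tensor_eq_trans tr.
Qed.

Canonical tensor_equiv :=
  EquivRel tensor_rel tensor_rel_refl tensor_rel_sym tensor_rel_trans.

(* B (x)_A B, with (x (x) y) * (x' (x) y') = x x' (x) y y'. *)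
Definition tensor : Type := {eq_quot tensor_equiv}%qT.

HB.instance Definition _ := Choice.on tensor.
HB.instance Definition _ := EqQuotient.on tensor.

Definition tensor_of s : tensor := (\pi_tensor s)%qT.
Definition tensor_repr (x : tensor) : seq (B * B) := generic_quotient.repr x.

Lemma tensor_ofP s t : tensor_of s = tensor_of t <-> tensor_eq s t.
Proof.
split=> [|st].
  by move/eqP; rewrite /tensor_of eqmodE => /asboolP.
by apply/eqP; rewrite /tensor_of eqmodE; apply/asboolP.
Qed.

Lemma tensor_reprK x : tensor_of (tensor_repr x) = x.
Proof. exact: reprK. Qed.

Lemma tensor_eq_repr s : tensor_eq (tensor_repr (tensor_of s)) s.
Proof. by apply/tensor_ofP; rewrite tensor_reprK. Qed.

Definition fs_opp s : seq (B * B) := [seq (- p.1, p.2) | p <- s].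

Definition fs_mul s t : seq (B * B) := [seq (p.1 * q.1, p.2 * q.2) | p <- s, q <- t].

Lemma tensor_eq_perm s t : perm_eq s t -> tensor_eq s t.
Proof.
elim: s t => [|p s IH] t.
  by move/perm_size/esym/size0nil->; exact: tensor_eq_refl.
move=> pst; have tp : p \in t by rewrite -(perm_mem pst) mem_head.
have /splitPr E := tp; case: E pst => t1 t2 pst.
have pst' : perm_eq s (t1 ++ t2).
  by rewrite -(perm_cons p) (perm_trans pst) // perm_sym -cat1s perm_catCA perm_refl.
apply: (@tensor_eq_trans _ ([:: p] ++ (t1 ++ t2))).
  by apply: (@tensor_eq_cat [:: p]); [exact: tensor_eq_refl | exact: IH].
rewrite catA -[t1 ++ p :: t2]/(t1 ++ [:: p] ++ t2) catA.
by apply: tensor_eq_cat; [exact: tensor_eq_catC | exact: tensor_eq_refl].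
Qed.

Lemma tensor_eq_oppl s : tensor_eq (fs_opp s ++ s) [::].
Proof.
elim: s => [|[x y] s IH]; first exact: tensor_eq_refl.
apply: (@tensor_eq_trans _ ([:: (- x, y); (x, y)] ++ (fs_opp s ++ s))).
  apply: tensor_eq_perm; rewrite /= perm_cons.
  by rewrite -[(x, y) :: s]cat1s perm_catCA perm_refl.
rewrite -[nil]cat0s; apply: tensor_eq_cat => //.
apply: tensor_eq_trans (tensor_eq_sym (tensor_eq_Dl _ _ _)) _.
by rewrite addNr; exact: tensor_eq0.
Qed.

Lemma tensor_eq_oppr s : tensor_eq (s ++ fs_opp s) [::].
Proof. exact: tensor_eq_trans (tensor_eq_catC _ _) (tensor_eq_oppl s). Qed.

Lemma tensor_eq_opp s t : tensor_eq s t -> tensor_eq (fs_opp s) (fs_opp t).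
Proof.
move=> st.
apply: (@tensor_eq_trans _ (fs_opp s ++ (t ++ fs_opp t))).
  rewrite -{1}[fs_opp s]cats0; apply: tensor_eq_cat; first exact: tensor_eq_refl.
  exact/tensor_eq_sym/tensor_eq_oppr.
rewrite catA -[X in tensor_eq _ X]cat0s.
apply: tensor_eq_cat; last exact: tensor_eq_refl.
apply: tensor_eq_trans (tensor_eq_oppl s).
by apply: tensor_eq_cat; [exact: tensor_eq_refl | exact: tensor_eq_sym].
Qed.

Lemma fs_mul_catl s s' t : fs_mul (s ++ s') t = fs_mul s t ++ fs_mul s' t.
Proof. by rewrite /fs_mul map_cat flatten_cat. Qed.

Lemma fs_mulC s t : perm_eq (fs_mul s t) (fs_mul t s).
Proof.
elim: s => [|p s IH]; first by rewrite /fs_mul allpairs0r.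
rewrite perm_sym /fs_mul (perm_allpairs_consr _ _ (fun=> p) (fun=> s)) /= -/(fs_mul s t).
rewrite -/(fs_mul t s) (_ : [seq _ | q <- t] = [seq (p.1 * q.1, p.2 * q.2) | q <- t]).
  by rewrite perm_cat2l perm_sym.
by apply: eq_map => q; rewrite mulrC [q.2 * _]mulrC.
Qed.

Lemma fs_mul1s p t : fs_mul [:: p] t = [seq (p.1 * q.1, p.2 * q.2) | q <- t].
Proof. by rewrite /fs_mul /= cats0. Qed.

Lemma fs_mul_eql s s' t : tensor_eq s s' -> tensor_eq (fs_mul s t) (fs_mul s' t).
Proof.
have dup (F F1 F2 : B * B -> B * B) :
    (forall q, tensor_eq [:: F q] [:: F1 q; F2 q]) ->
  tensor_eq (map F t) (map F1 t ++ map F2 t).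
  move=> FE; elim: t => [|q r IH]; first exact: tensor_eq_refl.
  apply: (@tensor_eq_trans _ ([:: F1 q; F2 q] ++ (map F1 r ++ map F2 r))).
    exact: (@tensor_eq_cat [:: F q]).
  apply: tensor_eq_perm; rewrite /= perm_cons.
  by rewrite -[F2 q :: map F2 r]cat1s -cat1s perm_catCA perm_refl.
elim=> {s s'} [s|s s' _|s s' r _ + _|s s' r r' _ + _|s s'|x x' y|x y y'|y|a x y].
- exact: tensor_eq_refl.
- exact: tensor_eq_sym.
- exact: tensor_eq_trans.
- by rewrite !fs_mul_catl; exact: tensor_eq_cat.
- by rewrite !fs_mul_catl; exact: tensor_eq_catC.
- rewrite -[[:: (x, y); _]]/([:: (x, y)] ++ [:: (x', y)]) fs_mul_catl !fs_mul1s.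
  by apply: dup => q /=; rewrite mulrDl; exact: tensor_eq_Dl.
- rewrite -[[:: (x, y); _]]/([:: (x, y)] ++ [:: (x, y')]) fs_mul_catl !fs_mul1s.
  by apply: dup => q /=; rewrite mulrDl; exact: tensor_eq_Dr.
- rewrite fs_mul1s; elim: t {dup} => [|q r IH]; first exact: tensor_eq_refl.
  apply: (@tensor_eq_cat [:: _] [::] _ [::]) => //=.
  by rewrite mul0r; exact: tensor_eq0.
- rewrite !fs_mul1s; elim: t {dup} => [|q r IH]; first exact: tensor_eq_refl.
  apply: (@tensor_eq_cat [:: _] [:: _]) => //=.
  by rewrite -!mulrA; exact: tensor_eqZ.
Qed.

Lemma fs_mul_eq s s' t t' :
  tensor_eq s s' -> tensor_eq t t' -> tensor_eq (fs_mul s t) (fs_mul s' t').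
Proof.
move=> ss' tt'; apply: tensor_eq_trans (fs_mul_eql _ ss') _.
apply: tensor_eq_trans (tensor_eq_perm (fs_mulC _ _)) _.
apply: tensor_eq_trans (fs_mul_eql _ tt') _.
exact: tensor_eq_perm (fs_mulC _ _).
Qed.

Definition tensor_zero : tensor := tensor_of [::].
Definition tensor_one : tensor := tensor_of [:: (1, 1)].
Definition tensor_add (x y : tensor) : tensor :=
  tensor_of (tensor_repr x ++ tensor_repr y).
Definition tensor_opp (x : tensor) : tensor := tensor_of (fs_opp (tensor_repr x)).
Definition tensor_mul (x y : tensor) : tensor :=
  tensor_of (fs_mul (tensor_repr x) (tensor_repr y)).

Lemma tensor_addE s t : tensor_add (tensor_of s) (tensor_of t) = tensor_of (s ++ t).
Proof. by apply/tensor_ofP/tensor_eq_cat; exact: tensor_eq_repr. Qed.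
Lemma tensor_oppE s : tensor_opp (tensor_of s) = tensor_of (fs_opp s).
Proof. by apply/tensor_ofP/tensor_eq_opp; exact: tensor_eq_repr. Qed.
Lemma tensor_mulE s t : tensor_mul (tensor_of s) (tensor_of t) = tensor_of (fs_mul s t).
Proof. by apply/tensor_ofP/fs_mul_eq; exact: tensor_eq_repr. Qed.

Fact tensor_addA : associative tensor_add.
Proof.
move=> x y z; rewrite -(tensor_reprK x) -(tensor_reprK y) -(tensor_reprK z).
by rewrite !tensor_addE catA.
Qed.
Fact tensor_addC : commutative tensor_add.
Proof. by move=> x y; apply/tensor_ofP/tensor_eq_catC. Qed.
Fact tensor_add0 : left_id tensor_zero tensor_add.
Proof. by move=> x; rewrite -(tensor_reprK x) tensor_addE. Qed.
Fact tensor_addN : left_inverse tensor_zero tensor_opp tensor_add.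
Proof.
move=> x; rewrite -(tensor_reprK x) tensor_oppE tensor_addE.
exact/tensor_ofP/tensor_eq_oppl.
Qed.

HB.instance Definition _ := GRing.isZmodule.Build tensor
  tensor_addA tensor_addC tensor_add0 tensor_addN.

Fact tensor_mulA : associative tensor_mul.
Proof.
move=> x y z; rewrite -(tensor_reprK x) -(tensor_reprK y) -(tensor_reprK z).
rewrite !tensor_mulE; congr tensor_of.
have mul1 p s t : fs_mul [:: p] (fs_mul s t) = fs_mul (fs_mul [:: p] s) t.
  rewrite !fs_mul1s; elim: s => [|q s IH] //.
  rewrite /fs_mul /= map_cat -map_comp -/(fs_mul s t) IH; congr (_ ++ _).
  by apply: eq_map => r /=; rewrite !mulrA.
move: (tensor_repr x) (tensor_repr y) (tensor_repr z) => s t r.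
elim: s => [|p s IH] //.
by rewrite -cat1s 2!(fs_mul_catl [:: p] s) fs_mul_catl IH mul1.
Qed.
Fact tensor_mulC : commutative tensor_mul.
Proof. by move=> x y; apply/tensor_ofP/tensor_eq_perm/fs_mulC. Qed.
Fact tensor_mul1 : left_id tensor_one tensor_mul.
Proof.
move=> x; rewrite -(tensor_reprK x) tensor_mulE fs_mul1s; congr tensor_of.
by rewrite -[RHS]map_id; apply: eq_map => -[a b] /=; rewrite !mul1r.
Qed.
Fact tensor_mulDl : left_distributive tensor_mul +%R.
Proof.
move=> x y z; rewrite -(tensor_reprK x) -(tensor_reprK y) -(tensor_reprK z).
by rewrite -[_ + _]/(tensor_add _ _) -[RHS]/(tensor_add _ _)
  !(tensor_addE, tensor_mulE) fs_mul_catl.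
Qed.

HB.instance Definition _ := GRing.Zmodule_isComPzRing.Build tensor
  tensor_mulA tensor_mulC tensor_mul1 tensor_mulDl.

Definition pure_tensor (x y : B) : tensor := tensor_of [:: (x, y)].

End Tensor.

(* The action of [gT] on [B] is a left action by ring endomorphisms, which are
   automorphisms by [galois_act1] and [galois_actM].  The condition [B^G = A]
   means that [u] is an isomorphism of [A] onto the subring of invariants.  The
   first clause of [galois_rho] determines [rho], since pure tensors generate the
   tensor product. *)
Record galois (A B : comPzRingType) (u : {rmorphism A -> B}) (gT : finGroupType) :=
  Galois {
    galois_act :> gT -> {rmorphism B -> B};
    galois_act1 : forall b, galois_act 1%g b = b;
    galois_actM : forall g h b,
      galois_act (g * h)%g b = galois_act g (galois_act h b);
    galois_inj : injective u;
    galois_inv : forall b,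
      (forall g, galois_act g b = b) <-> (exists a, u a = b);
    galois_rho : exists rho : {rmorphism tensor u -> {ffun gT -> B}},
      (forall x y g, rho (pure_tensor u x y) g = x * galois_act g y)
      /\ bijective rho;
    galois_fg : finitely_generated (alg_of u);
    galois_proj : projective (alg_of u)
  }.

Section WeightSpaces.
Variables (A B : comPzRingType) (u : {rmorphism A -> B}) (gT : finGroupType).
Variables (D : galois u gT) (T : unitSubgroup A).
Implicit Types theta : dual gT T.

Lemma galois_act_u g a : D g (u a) = u a.
Proof. by move: g; apply/galois_inv; exists a. Qed.

(* The submodule L_theta of [B]. *)
Definition weight_pred theta : {pred alg_of u} :=
  [pred b | [forall g, u (us_val (dual_fun theta g)) * D g b == b]].

Lemma weightP theta (b : alg_of u) :
  reflect (forall g, u (us_val (dual_fun theta g)) * D g b = b)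
          (b \in weight_pred theta).
Proof. by apply: (iffP forallP) => bL g; apply/eqP; exact: bL. Qed.

Fact weight_submod_closed theta : submod_closed (weight_pred theta).
Proof.
split=> [|a x y /weightP Lx /weightP Ly]; apply/weightP => g.
  by rewrite rmorph0 mulr0.
rewrite alg_scaleE rmorphD rmorphM /= galois_act_u mulrDr Ly mulrCA Lx //.
Qed.

HB.instance Definition _ theta := GRing.isSubmodClosed.Build A (alg_of u)
  (weight_pred theta) (weight_submod_closed theta).

Record weight theta : Type :=
  Weight { weight_val : alg_of u; weight_valP : weight_val \in weight_pred theta }.

HB.instance Definition _ theta := [isSub for @weight_val theta].
HB.instance Definition _ theta := [Choice of weight theta by <:].
HB.instance Definition _ theta := [SubChoice_isSubLmodule of weight theta by <:].

Fact weight_one_proof : (1 : alg_of u) \in weight_pred 1%g.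
Proof. by apply/weightP=> g; rewrite dual1E us_val1 !rmorph1 mulr1. Qed.

Lemma weight_mul_proof (s t : dual gT T) (x : weight s) (y : weight t) r :
  (s * t)%g = r -> weight_val x * weight_val y \in weight_pred r.
Proof.
move=> <-; apply/weightP=> g; rewrite dualME us_valM !rmorphM /= mulrACA.
by rewrite (weightP _ _ (weight_valP x)) (weightP _ _ (weight_valP y)).
Qed.

(* [dual gT T] is finite, so the direct sum of the L_theta is their product as a
   module; the ring structure is not the componentwise one but the graded one,
   [ws_mul]. *)
Definition weight_sum : Type := {dffun forall theta, weight theta}.

HB.instance Definition _ := Choice.copy weight_sum {dffun forall theta, weight theta}.

Definition component (x : weight_sum) theta : weight theta := x theta.

Lemma weight_sumP (x y : weight_sum) :
  (forall theta, weight_val (component x theta) = weight_val (component y theta)) ->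
  x = y.
Proof. by move=> xy; apply/ffunP=> theta; exact/val_inj/xy. Qed.

Definition ws_mk (F : forall theta, weight theta) : weight_sum := [ffun theta => F theta].

Lemma componentE F theta : component (ws_mk F) theta = F theta.
Proof. exact: ffunE. Qed.

Definition ws_zero : weight_sum := ws_mk (fun _ => 0).
Definition ws_opp x : weight_sum := ws_mk (fun theta => - component x theta).
Definition ws_add x y : weight_sum :=
  ws_mk (fun theta => component x theta + component y theta).
Definition ws_scale (a : A) x : weight_sum := ws_mk (fun theta => a *: component x theta).

Fact ws_addA : associative ws_add.
Proof. by move=> x y z; apply: weight_sumP => theta; rewrite !componentE addrA. Qed.
Fact ws_addC : commutative ws_add.
Proof. by move=> x y; apply: weight_sumP => theta; rewrite !componentE addrC. Qed.
Fact ws_add0 : left_id ws_zero ws_add.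
Proof. by move=> x; apply: weight_sumP => theta; rewrite !componentE add0r. Qed.
Fact ws_addN : left_inverse ws_zero ws_opp ws_add.
Proof. by move=> x; apply: weight_sumP => theta; rewrite !componentE addNr. Qed.

HB.instance Definition _ := GRing.isZmodule.Build weight_sum
  ws_addA ws_addC ws_add0 ws_addN.

Lemma componentD (x y : weight_sum) theta :
  component (x + y) theta = component x theta + component y theta.
Proof. exact: componentE. Qed.

Fact ws_scaleA a b x : ws_scale a (ws_scale b x) = ws_scale (a * b) x.
Proof. by apply: weight_sumP => theta; rewrite !componentE scalerA. Qed.
Fact ws_scale1 : left_id 1 ws_scale.
Proof. by move=> x; apply: weight_sumP => theta; rewrite !componentE scale1r. Qed.
Fact ws_scaleDr : right_distributive ws_scale +%R.
Proof. by move=> a x y; apply: weight_sumP => theta; rewrite !componentE scalerDr. Qed.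
Fact ws_scaleDl x : {morph ws_scale^~ x : a b / a + b}.
Proof. by move=> a b; apply: weight_sumP => theta; rewrite !componentE scalerDl. Qed.

HB.instance Definition _ := GRing.Zmodule_isLmodule.Build A weight_sum
  ws_scaleA ws_scale1 ws_scaleDr ws_scaleDl.

Definition ws_inj theta (b : weight theta) : weight_sum :=
  ws_mk (dfwith (fun t => 0 : weight t) b).

Lemma ws_inj_in theta (b : weight theta) : component (ws_inj b) theta = b.
Proof. by rewrite componentE dfwith_in. Qed.

Lemma ws_inj_out theta t (b : weight theta) : theta != t -> component (ws_inj b) t = 0.
Proof. by move=> tt'; rewrite componentE dfwith_out. Qed.

Fact ws_mul_proof (x y : weight_sum) theta :
  \sum_(p : dual gT T * dual gT T | (p.1 * p.2)%g == theta)
     weight_val (component x p.1) * weight_val (component y p.2)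
  \in weight_pred theta.
Proof. by apply: rpred_sum => p /eqP pt; exact: weight_mul_proof. Qed.

Definition ws_mul x y : weight_sum := ws_mk (fun theta => Weight (ws_mul_proof x y theta)).

Definition ws_one : weight_sum := ws_inj (Weight weight_one_proof).

Lemma weight_val_is_linear theta : linear (@weight_val theta).
Proof. by []. Qed.

HB.instance Definition _ theta := GRing.isLinear.Build A (weight theta) (alg_of u) _
  (@weight_val theta) (@weight_val_is_linear theta).

Lemma ws_mulE x y theta : weight_val (component (ws_mul x y) theta) =
  \sum_(a : dual gT T)
     weight_val (component x a) * weight_val (component y (a^-1 * theta)%g).
Proof.
rewrite componentE /= -(pair_big_dep predT (fun a b => (a * b)%g == theta)
  (fun a b => weight_val (component x a) * weight_val (component y b))) /=.
apply: eq_bigr => a _; rewrite (big_pred1 (a^-1 * theta)%g) // => b.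
by rewrite /=; apply/eqP/eqP => [<-|->]; rewrite ?mulKg ?mulKVg.
Qed.

Fact ws_mulA : associative ws_mul.
Proof.
move=> x y z; apply: weight_sumP => theta; rewrite !ws_mulE.
under eq_bigr do rewrite ws_mulE mulr_sumr.
under [RHS]eq_bigr do rewrite ws_mulE mulr_suml.
rewrite [RHS]exchange_big /=; apply: eq_bigr => a _.
rewrite (reindex_inj (mulgI a^-1%g)) /=; apply: eq_bigr => b _.
by rewrite mulrA invMg invgK -mulgA mulKVg.
Qed.
Fact ws_mulC : commutative ws_mul.
Proof.
move=> x y; apply: weight_sumP => theta; rewrite !ws_mulE.
rewrite (reindex_inj (can_inj (fun a => invgK a))) (reindex_inj (mulIg theta^-1%g)) /=.
apply: eq_bigr => a _; rewrite mulrC invgK mulgVK invMg invgK; congr (_ * _).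
by rewrite dual_mulC.
Qed.
Fact ws_mul1 : left_id ws_one ws_mul.
Proof.
move=> x; apply: weight_sumP => theta; rewrite ws_mulE (bigD1 1%g) //= big1 ?addr0.
  by rewrite ws_inj_in mul1r invg1 mul1g.
by move=> a a1; rewrite ws_inj_out ?raddf0 ?mul0r // eq_sym.
Qed.
Fact ws_mulDl : left_distributive ws_mul +%R.
Proof.
move=> x y z; apply: weight_sumP => theta.
rewrite componentD raddfD /= !ws_mulE -big_split /=; apply: eq_bigr => a _.
by rewrite componentD raddfD mulrDl.
Qed.

HB.instance Definition _ := GRing.Zmodule_isComPzRing.Build weight_sum
  ws_mulA ws_mulC ws_mul1 ws_mulDl.

Lemma ws_scaleAl (a : A) (x y : weight_sum) : a *: (x * y) = a *: x * y.
Proof.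
apply: weight_sumP => theta; rewrite componentE linearZ /= !ws_mulE scaler_sumr.
by apply: eq_bigr => t _; rewrite componentE linearZ /= !alg_scaleE mulrA.
Qed.

(* The morphism induced by the inclusions L_theta -> B, cf. [ws_map_inj]. *)
Definition ws_map (x : weight_sum) : alg_of u :=
  \sum_(theta : dual gT T) weight_val (component x theta).

Lemma ws_map_inj theta (b : weight theta) : ws_map (ws_inj b) = weight_val b.
Proof.
rewrite /ws_map (bigD1 theta) //= ws_inj_in big1 ?addr0 // => t tt'.
by rewrite ws_inj_out ?raddf0 // eq_sym.
Qed.

Fact ws_map_is_linear : linear ws_map.
Proof.
move=> a x y; rewrite /ws_map scaler_sumr -big_split /=.
by apply: eq_bigr => theta _; rewrite !componentE linearP.
Qed.

HB.instance Definition _ := GRing.isLinear.Build A weight_sum (alg_of u) _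
  ws_map ws_map_is_linear.

Fact ws_map_is_monoid_morphism : monoid_morphism ws_map.
Proof.
split=> [|x y]; first by rewrite ws_map_inj.
rewrite /ws_map mulr_suml.
under eq_bigr do rewrite ws_mulE.
rewrite exchange_big; apply: eq_bigr => a _ /=.
by rewrite mulr_sumr (reindex_inj (mulgI a)) /=; apply: eq_bigr => b _; rewrite mulKg.
Qed.

HB.instance Definition _ := GRing.isMonoidMorphism.Build weight_sum (alg_of u)
  ws_map ws_map_is_monoid_morphism.

End WeightSpaces.

(* Main.v *)
(** Write [d] for the order of [G]. The polynomial 1 + X + ... + X^(N-1) splits over [A] as
    the product of the X - t for t <> 1 in [T], so N = prod (1 - t) is invertible in [A],
    and so is its divisor [d]. Hence b |-> d^-1 * sum_g theta(g) g(b) makes sense and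
    lands in L_theta. As 1 - t is invertible for t <> 1, nontrivial character sums vanish;
    this applies on [G], and on [G'] because the characters with values in [T]
    separate the points of [G]. The two orthogonality relations say that these
    operators are the projections of a decomposition of [B] as the sum of the L_theta. *)

Require Import Defs.
From HB Require Import structures.
From mathcomp Require Import all_boot all_fingroup all_algebra all_solvable.
From mathcomp Require Import algC cyclotomic classfun character.

Import GRing.Theory.
Local Open Scope ring_scope.

(** * Invertibility of the order of [T] in [A] *)

(** Roots split off one at a time, even with zero divisors: when p = q * prod (X - y) is evaluated
    at a further root x, the factors x - y are regular, so q(x) = 0. *)
Lemma factor_lreg_roots (R : comNzRingType) (p : {poly R}) (s : seq R) :
    uniq s -> {in s, forall x, root p x} ->
    {in s &, forall x y, x != y -> GRing.lreg (x - y)} ->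
  exists q, p = q * \prod_(x <- s) ('X - x%:P).
Proof.
elim: s => [|x s IHs] /=; first by exists p; rewrite big_nil mulr1.
case/andP=> xs us rs ds.
have [||q pq] := IHs us; first by move=> y ys; apply: rs; rewrite inE ys orbT.
  by move=> y z ys zs; apply: ds; rewrite inE ?ys ?zs orbT.
have /factor_theorem[q1 q1E] : root q x.
  have lregP : GRing.lreg (\prod_(y <- s) (x - y)).
    rewrite big_seq; apply: (big_ind (@GRing.lreg R)) => [||y ys].
    - exact: lreg1.
    - exact: lregM.
    - apply: ds; rewrite ?inE ?eqxx ?ys ?orbT //.
      by apply: contraNneq xs => ->.
  have := rs x (mem_head _ _); rewrite /root pq hornerM horner_prod.
  under eq_bigr do rewrite hornerXsubC.
  by rewrite mulrC mulrI_eq0.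
by exists q1; rewrite big_cons mulrA -q1E.
Qed.

(** With n the size of [s], both sides are the value at 1 of 1 + X + ... + X^n, the left one through
    its factorization. *)
Lemma prod_one_sub_unity_roots (R : comNzRingType) (s : seq R) :
    uniq (1 :: s) -> {in s, forall x, x ^+ (size s).+1 = 1} ->
    {in 1 :: s &, forall x y, x != y -> GRing.lreg (x - y)} ->
  \prod_(x <- s) (1 - x) = (size s).+1%:R.
Proof.
move=> /= /andP[s1 us] rs ds; pose p : {poly R} := \poly_(i < (size s).+1) 1.
have p1 : p.[1] = (size s).+1%:R.
  rewrite horner_poly (eq_bigr (fun=> 1)) ?sumr_const ?card_ord // => i _.
  by rewrite expr1n mulr1.
have [||q pq] := factor_lreg_roots R p s us.
- move=> x xs; rewrite /root horner_poly.
  (* Since x - 1 is regular and (x - 1) p(x) = x^(n+1) - 1 = 0, x is a root. *)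
  have /mulrI_eq0 <- : GRing.lreg (x - 1).
    by apply: ds; rewrite ?inE ?eqxx ?xs ?orbT //; apply: contraNneq s1 => <-.
  under eq_bigr do rewrite mul1r.
  by rewrite -subrX1 rs // subrr.
- by move=> x y xs ys; apply: ds; rewrite inE ?xs ?ys orbT.
have P_monic : \prod_(x <- s) ('X - x%:P) \is monic.
  exact: monic_prod_XsubC.
have sp : size p = (size s).+1 by rewrite size_poly_eq // oner_neq0.
have q_neq0 : q != 0.
  by apply: contra_eq_neq sp => q0; rewrite pq q0 mul0r size_poly0.
(* [p] and the monic product have equal degrees, so [q] is a constant, namely the leading
   coefficient 1 of [p]. *)
have q1 : q = 1.
  have sq : (size q <= 1)%N.
    move: sp; rewrite pq size_Mmonic // size_prod_XsubC addnS /=.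
    by rewrite -add1n => /addIn ->.
  have := lead_coef_Mmonic q P_monic; rewrite -pq lead_coef_poly ?oner_neq0 //.
  by rewrite (size1_polyC sq) lead_coefC => <-.
rewrite -p1 pq q1 mul1r horner_prod.
by under [RHS]eq_bigr do rewrite hornerXsubC.
Qed.

Lemma invertible_lreg (A : comPzRingType) (x : A) : invertible x -> GRing.lreg x.
Proof. by case=> y xy z t /= e; rewrite -[z]mul1r -[t]mul1r -xy mulrAC e mulrAC. Qed.

Lemma invertibleM (A : comPzRingType) (x y : A) :
  invertible x -> invertible y -> invertible (x * y).
Proof. by case=> x' xx' [y' yy']; exists (x' * y'); rewrite mulrACA xx' yy' mulr1. Qed.

Lemma us_valVr (A : comPzRingType) (T : unitSubgroup A) (t : us_elt T) :
  us_val t * us_val t^-1%g = 1.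
Proof. by rewrite -us_valM mulgV us_val1. Qed.

Lemma us_valX (A : comPzRingType) (T : unitSubgroup A) (t : us_elt T) n :
  us_val (t ^+ n)%g = us_val t ^+ n.
Proof. by elim: n => [|n IHn]; rewrite ?expg0 ?us_val1 // expgS exprS us_valM IHn. Qed.

(** s - t = s (1 - s^-1 t) is a product of two invertible elements. *)
Lemma us_sub_lreg (A : comPzRingType) (T : unitSubgroup A) :
    (forall t : us_elt T, t <> 1%g -> invertible (1 - us_val t)) ->
  forall s t : us_elt T, s != t -> GRing.lreg (us_val s - us_val t).
Proof.
move=> Tinv s t st; apply: invertible_lreg.
have -> : us_val s - us_val t = us_val s * (1 - us_val (s^-1 * t)%g).
  by rewrite mulrBr mulr1 -us_valM mulKVg.
apply: invertibleM; first by exists (us_val s^-1%g); exact: us_valVr.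
by apply: Tinv => /(congr1 (fun x => s * x)%g); rewrite mulKVg mulg1 => ts; rewrite ts eqxx in st.
Qed.

Lemma invertible_card_us (A : comPzRingType) (T : unitSubgroup A) :
    (forall t : us_elt T, t <> 1%g -> invertible (1 - us_val t)) ->
  invertible (#|[set: us_elt T]|%:R : A).
Proof.
(* The zero ring is set apart because the factorization above is over nonzero rings. *)
move=> Tinv; have [A0|A1] := eqVneq (1 : A) 0.
  by exists 0; rewrite mulr0 A0.
pose R : comNzRingType := HB.pack (GRing.ComPzRing.sort A) (GRing.PzSemiRing_isNonZero.Build A A1).
pose e := rem 1%g (enum [set: us_elt T]); pose s : seq R := map (@us_val A T) e.
have e1 : perm_eq (1%g :: e) (enum [set: us_elt T]).
  by rewrite perm_sym perm_to_rem // mem_enum inE.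
have ss : (size s).+1 = #|[set: us_elt T]| by rewrite size_map cardE -(perm_size e1).
have se : (1 : R) :: s = map (@us_val A T) (1%g :: e) by [].
have prodE : \prod_(x <- s) (1 - x) = (size s).+1%:R.
  apply: prod_one_sub_unity_roots.
  - rewrite se (map_inj_uniq (@us_val_inj A T)) (perm_uniq e1); exact: enum_uniq.
  - move=> _ /mapP[t _ ->]; rewrite ss; transitivity (us_val (t ^+ #|[set: us_elt T]|)%g).
      by rewrite us_valX.
    by rewrite expg_cardG ?inE.
  - rewrite se => _ _ /mapP[x _ ->] /mapP[y _ ->] xy.
    refine (us_sub_lreg A T Tinv x y _).
    by apply: contraNneq xy => ->.
have -> : (#|[set: us_elt T]|%:R : A) = \prod_(t <- e) (1 - us_val t).
  by rewrite -ss; rewrite big_map in prodE; rewrite prodE.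
rewrite big_seq; apply: (big_ind (@invertible A)) => [||t te].
- by exists 1; rewrite mulr1.
- exact: invertibleM.
apply: Tinv => t1; move: te; rewrite t1 mem_rem_uniq ?enum_uniq //.
by rewrite inE eqxx.
Qed.

(** * Characters with values in [T] and their orthogonality relations *)

Lemma dual_separates (gT : finGroupType) (A : comPzRingType) (T : unitSubgroup A) (g : gT) :
    cyclic [set: us_elt T] -> abelian [set: gT] ->
    (#|[set: gT]| %| #|[set: us_elt T]|)%N -> g != 1%g ->
  exists theta : dual gT T, dual_fun theta g != 1%g.
Proof.
(* Complex characters of the group separate points; as their values are N-th roots of
   unity, they can be moved to [T] through generators. *)
set N := #|[set: us_elt T]| => /cyclicP[t Tt] abG dvdN g1.
have ot : #[t]%g = N by rewrite /N Tt.
have N0 : (0 < N)%N by rewrite -ot order_gt0.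
have [w w_prim] := C_prim_root_exists N0.
have /existsP[i gi] : [exists i : Iirr [set: gT], g \notin cfker 'chi_i].
  rewrite -negb_forall; apply: contra g1 => /forallP gker.
  suff : g \in (\bigcap_(i : Iirr [set: gT]) cfker 'chi_i)%g.
    by rewrite TI_cfker_irr inE.
  by apply/bigcapP => i _.
have chi_lin : 'chi_i \is a linear_char by apply/char_abelianP.
have chiN h : 'chi_i h ^+ N = 1.
  have oh : (#[h]%g %| N)%N.
    by apply: dvdn_trans dvdN; apply: order_dvdG; rewrite inE.
  by rewrite -(divnK oh) mulnC exprM lin_char_unity_root ?inE // expr1n.
have chiE h : exists k : nat, 'chi_i h == w ^+ k.
  by have [k ->] := prim_rootP w_prim (chiN h); exists k.
pose k h := xchoose (chiE h).
have kP h : 'chi_i h = w ^+ k h := eqP (xchooseP (chiE h)).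
(* Both [w] and [t] have order [N], so the power of [t] does not depend on the exponent chosen for
   [w]. *)
have tE m n : w ^+ m = w ^+ n -> (t ^+ m = t ^+ n)%g.
  move/eqP; rewrite (eq_prim_root_expr w_prim) -ot => /eqP mn.
  by apply/eqP; rewrite eq_expg_mod_order mn.
have theta_morph : morphic [set: gT] [ffun h => (t ^+ k h)%g].
  apply/morphicP => x y _ _; rewrite !ffunE -expgD; apply: tE.
  by rewrite exprD -!kP lin_charM ?inE.
exists (dual_mk theta_morph); rewrite /dual_fun /= ffunE.
(* If the character were trivial at [g], [N] would divide [k g] and [g] would lie in the kernel of
   the complex character. *)
apply: contra gi; rewrite -order_dvdn ot => /dvdnP[m km].
by rewrite cfkerEchar ?irr_char // inE inE /= kP km mulnC exprM
  (prim_expr_order w_prim) expr1n lin_char1.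
Qed.

(** Translation by [k] multiplies the sum S by chi(k), so (1 - chi(k)) S = 0 with a regular
    factor. *)
Lemma sum_character_eq0 (A : comPzRingType) (K : finGroupType) (chi : K -> A) (k : K) :
    {morph chi : x y / (x * y)%g >-> x * y} -> invertible (1 - chi k) ->
  \sum_x chi x = 0.
Proof.
move=> chiM /invertible_lreg; apply; rewrite /= mulr0 mulrBl mul1r mulr_sumr.
apply/eqP; rewrite subr_eq0 [X in X == _](reindex_inj (mulgI k)) /=; apply/eqP.
by apply: eq_bigr => x _; rewrite chiM.
Qed.

Section Orthogonality.
Variables (gT : finGroupType) (A : comPzRingType) (T : unitSubgroup A).
Hypothesis Tinv : forall t : us_elt T, t <> 1%g -> invertible (1 - us_val t).

Lemma sum_dual_fun (theta : dual gT T) :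
  \sum_g us_val (dual_fun theta g) = if theta == 1%g then #|gT|%:R else 0.
Proof.
case: eqVneq => [->|theta1].
  under eq_bigr do rewrite dual1E us_val1.
  by rewrite sumr_const.
have /existsP[g g1] : [exists g, dual_fun theta g != 1%g].
  rewrite -negb_forall; apply: contra theta1 => /forallP theta1.
  by apply/eqP/dual_ext => g; rewrite dual1E; apply/eqP.
apply: (@sum_character_eq0 A gT _ g) => [x y|]; first by rewrite dual_funM us_valM.
exact/Tinv/eqP.
Qed.

Lemma sum_dual_at (g : gT) :
    cyclic [set: us_elt T] -> abelian [set: gT] ->
    (#|[set: gT]| %| #|[set: us_elt T]|)%N ->
  \sum_(theta : dual gT T) us_val (dual_fun theta g) = if g == 1%g then #|gT|%:R else 0.
Proof.
move=> cycT abG dvdN.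
have sum0 h : h != 1%g -> \sum_(theta : dual gT T) us_val (dual_fun theta h) = 0.
  move=> h1; have [theta theta_h] := dual_separates gT A T h cycT abG dvdN h1.
  apply: (@sum_character_eq0 A (dual gT T) _ theta) => [x y|].
    by rewrite dualME us_valM.
  exact/Tinv/eqP.
case: eqVneq => [->|]; last exact: sum0.
(* That the number of characters is the order of the group in [A] comes from summing
   theta(h) over all pairs (theta, h). *)
transitivity (\sum_(h : gT) \sum_(theta : dual gT T) us_val (dual_fun theta h)).
  by rewrite [RHS](bigD1 1%g) //= [X in _ + X]big1 ?addr0.
(* Summing over [h] first, only the trivial theta contributes. *)
rewrite exchange_big /=; under eq_bigr do rewrite sum_dual_fun.
by rewrite -big_mkcond big_pred1_eq.
Qed.

End Orthogonality.

(** * Projections onto the L_theta *)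

Section Projection.
Variables (A B : comPzRingType) (u : {rmorphism A -> B}) (gT : finGroupType).
Variables (D : galois u gT) (T : unitSubgroup A) (c : A).

Definition weight_proj (theta : dual gT T) (b : alg_of u) : alg_of u :=
  c *: \sum_g us_val (dual_fun theta g) *: (D g b : alg_of u).

(** Applying theta(h) h to theta(g) g(b) gives theta(hg) (hg)(b), so the sum is merely permuted. *)
Lemma weight_projP theta b : weight_proj theta b \in weight_pred D theta.
Proof.
apply: rpredZ; apply/weightP => h; rewrite rmorph_sum mulr_sumr.
rewrite [RHS](reindex_inj (mulgI h)) /=; apply: eq_bigr => g _.
by rewrite !alg_scaleE rmorphM /= galois_act_u mulrA -rmorphM -us_valM
  -dual_funM galois_actM.
Qed.

Lemma weight_proj_sum (I : finType) theta (F : I -> alg_of u) :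
  weight_proj theta (\sum_i F i) = \sum_i weight_proj theta (F i).
Proof.
rewrite /weight_proj -scaler_sumr exchange_big /=; congr (_ *: _).
by apply: eq_bigr => g _; rewrite rmorph_sum scaler_sumr.
Qed.

Hypothesis Tinv : forall t : us_elt T, t <> 1%g -> invertible (1 - us_val t).
Hypothesis c_inv : #|gT|%:R * c = 1.

(** On L_theta', g acts as the scalar theta'(g)^-1, so the operator is multiplication by c times the
    sum of the character theta theta'^-1. *)
Lemma weight_proj_weight theta theta' (b : alg_of u) :
  b \in weight_pred D theta' -> weight_proj theta b = if theta == theta' then b else 0.
Proof.
move=> /weightP Lb.
have act_b g : D g b = us_val (dual_fun theta'^-1%g g) *: b.
  rewrite -{2}(Lb g) alg_scaleE mulrA -rmorphM mulrC.
  by rewrite [_ * us_val (dual_fun theta' _)]mulrC -us_valM -dualME mulgV dual1E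
    us_val1 rmorph1 mulr1.
rewrite /weight_proj.
under eq_bigr do rewrite act_b scalerA -us_valM -dualME.
rewrite -scaler_suml scalerA sum_dual_fun // -eq_mulgV1.
by case: eqP => _; rewrite ?mulr0 ?scale0r // mulrC c_inv scale1r.
Qed.

Definition ws_proj (b : alg_of u) : weight_sum D T :=
  ws_mk (fun theta => Weight (weight_projP theta b)).

Lemma ws_mapK : cancel (@ws_map _ _ _ _ D T) ws_proj.
Proof.
move=> x; apply: weight_sumP => theta; rewrite componentE /= weight_proj_sum.
rewrite (bigD1 theta) //= (weight_proj_weight _ _ _ (weight_valP _)) eqxx.
rewrite big1 ?addr0 // => t /negPf tt'.
by rewrite (weight_proj_weight _ _ _ (weight_valP _)) eq_sym tt'.
Qed.

Lemma ws_projK :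
    cyclic [set: us_elt T] -> abelian [set: gT] ->
    (#|[set: gT]| %| #|[set: us_elt T]|)%N ->
  cancel ws_proj (@ws_map _ _ _ _ D T).
Proof.
move=> cycT abG dvdN b; rewrite /ws_map.
under eq_bigr do rewrite componentE /= /weight_proj.
rewrite -scaler_sumr exchange_big /=.
under eq_bigr do rewrite -scaler_suml sum_dual_at //.
(* The coefficient of g(b) is a sum over all characters, nonzero at most for g = 1. *)
rewrite (bigD1 1%g) //= big1 => [|g /negPf ->]; last by rewrite scale0r.
by rewrite addr0 eqxx scalerA mulrC c_inv scale1r galois_act1.
Qed.

End Projection.

(** * The isomorphism *)

Theorem mainTheorem9
  (N : nat) (N_gt0 : (0 < N)%N)
  (A : comPzRingType) (T : unitSubgroup A) (PT : P_subgroup N T)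
  (B : comPzRingType) (u : {rmorphism A -> B})
  (gT : finGroupType) (D : galois u gT)
  (abG : abelian [set: gT]) (dvdN : (#|[set: gT]| %| N)%N) :
  exists f : {rmorphism weight_sum D T -> alg_of u},
    [/\ scalable f,
        forall (theta : dual gT T) (b : weight D theta), f (ws_inj b) = weight_val b
      & exists h : {rmorphism alg_of u -> weight_sum D T},
          [/\ scalable h, cancel f h & cancel h f]].
Proof.
case: PT => cycT cardT Tinv; rewrite -cardT in dvdN.
have [c c_inv] : invertible (#|gT|%:R : A).
  have [c Nc] := invertible_card_us A T Tinv.
  (* If N = m d and N c = 1, then m c is an inverse of d. *)
  have /dvdnP[m mE] := dvdN; exists (m%:R * c).
  by rewrite mulrA -natrM mulnC -cardsT -mE.
have fK := ws_mapK A B u gT D T c Tinv c_inv.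
have hK := ws_projK A B u gT D T c Tinv c_inv cycT abG dvdN.
pose f : {rmorphism weight_sum D T -> alg_of u} := @ws_map A B u gT D T.
(* The inverse map inherits additivity and multiplicativity: identities are checked after applying
   the injective morphism [f]. *)
have hD : zmod_morphism (ws_proj A B u gT D T c).
  by move=> x y; apply: (can_inj fK); rewrite (raddfB f) /= !hK.
have hM : monoid_morphism (ws_proj A B u gT D T c).
  split=> [|x y]; apply: (can_inj fK); first by rewrite hK (rmorph1 f).
  by rewrite (rmorphM f) /= !hK.
pose h : {rmorphism alg_of u -> weight_sum D T} :=
  HB.pack (ws_proj A B u gT D T c)
    (GRing.isZmodMorphism.Build _ _ _ hD) (GRing.isMonoidMorphism.Build _ _ _ hM).
exists f; split=> [a x | theta b |]; [exact: linearZ | exact: ws_map_inj |].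
exists h; split=> // a x; apply: (can_inj fK).
by rewrite linearZ /= !hK.
Qed.
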